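(* Let $(X,\Sigma_d)$ be an arbitrary discrete space. Any Markov finitely additive kernel $P(x,E)$ on $(X,\Sigma_d)$ is uniquely representable as the sum of a sub-Markov countably additive kernel $P_{ca}(x,E)$ and a sub-Markov purely finitely additive kernel $P_{pfa}(x,E)$: $$P(x,E)=P_{ca}(x,E)+P_{pfa}(x,E),$$ where $P_{ca}(x,\cdot)\in ca(X,\Sigma_d)$, $P_{pfa}(x,\cdot)\in pfa(X,\Sigma_d)$, $P_{ca}(\cdot,E)\in B(X,\Sigma_d)$ and $P_{pfa}(\cdot,E)\in B(X,\Sigma_d)$ for all $x\in X$ and $E\in\Sigma_d$.
   Context: ''Arbitrary discrete space'' $(X,\Sigma_d)$: $X$ is an infinite set, $\Sigma_d=2^X$ is the sigma-algebra of all subsets of $X$, and the cardinality of $X$ is ''immeasurable'', meaning that every finite countably additive measure on $2^X$ that is zero on every one-point set is identically zero. $B(X,\Sigma_d)$ is the space of bounded $\Sigma_d$-measurable functions $X\to\mathbb R$ with the sup-norm. $ba(X,\Sigma_d)$ and $ca(X,\Sigma_d)$ are the spaces of bounded real-valued finitely additive, respectively countably additive, measures on $\Sigma_d$. A finitely additive measure $\mu\ge0$ is purely finitely additive if every countably additive measure $\lambda$ with $0\le\lambda\le\mu$ is identically zero; a signed measure is purely finitely additive if both components of its Jordan decomposition $\mu=\mu^+-\mu^-$ are. $pfa(X,\Sigma_d)$ is the space of bounded purely finitely additive measures. A sub-Markov kernel (finitely additive, countably additive or purely finitely additive) is a function $P(x,E)$, $x\in X$, $E\in\Sigma_d$, with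 $0\le P(x,E)\le1$, $P(\cdot,E)\in B(X,\Sigma_d)$ for all $E$, and $P(x,\cdot)$ in $ba$, $ca$ or $pfa$, respectively, for all $x\in X$. It is a Markov kernel if in addition $P(x,X)=1$ for all $x\in X$. *)

(* Defs.v *)
From mathcomp Require Import all_boot all_order all_algebra.
From mathcomp Require Import all_classical all_reals all_analysis.

Set Implicit Arguments.
Unset Strict Implicit.
Unset Printing Implicit Defensive.

Import Order.TTheory GRing.Theory Num.Theory.
Import numFieldNormedType.Exports.

Local Open Scope classical_set_scope.
Local Open Scope ring_scope.

(* The sets of the sigma-algebra are the [measurable] ones; the values that a
   set function takes on other sets are irrelevant.  In a discrete space there
   are no other sets. *)

Definition immeasurable (R : realType) (d : measure_display)
    (X : measurableType d) : Prop :=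
  forall mu : {finite_measure set X -> \bar R},
    (forall x : X, mu [set x] = 0%E) ->
    forall E : set X, measurable E -> mu E = 0%E.

(* The library's measurable types are pointed, which is no restriction on an
   infinite X. *)
Definition arbitrary_discrete_space (R : realType) (d : measure_display)
    (X : measurableType d) : Prop :=
  [/\ infinite_set [set: X],
      forall E : set X, measurable E
    & immeasurable R X].

Section SetFunctions.
Context {R : realType} {d : measure_display} {X : measurableType d}.
Implicit Types (mu lambda : set X -> R) (E F : set X).

Definition B : set (X -> R) :=
  [set f : X -> R | measurable_fun setT f /\ [bounded f x | x in [set: X]]].

(* For real-valued set functions, both additivity predicates below force the
   value 0 on the empty set. *)
Definition ba : set (set X -> R) :=
  [set mu : set X -> R | additive2 (EFin \o mu)
            /\ [bounded mu E | E in (measurable : set (set X))]].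

Definition ca : set (set X -> R) :=
  [set mu : set X -> R | sigma_additive (EFin \o mu)
            /\ [bounded mu E | E in (measurable : set (set X))]].

(* Jordan decomposition of a bounded finitely additive measure.  The library's
   [jordan_pos] and [jordan_neg] rely on a Hahn decomposition, which exists in
   general only for countably additive set functions. *)
Definition ba_jordan_pos mu : set X -> R :=
  fun E => sup [set mu F | F in [set F | measurable F /\ F `<=` E]].

Definition ba_jordan_neg mu : set X -> R :=
  fun E => - inf [set mu F | F in [set F | measurable F /\ F `<=` E]].

Definition purely_fa_ge0 mu : Prop :=
  (forall E, measurable E -> 0 <= mu E) /\
  (forall lambda, ca lambda ->
     (forall E, measurable E -> 0 <= lambda E <= mu E) ->
     forall E, measurable E -> lambda E = 0).

Definition pfa : set (set X -> R) :=
  [set mu : set X -> R | [/\ ba mu, purely_fa_ge0 (ba_jordan_pos mu)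
              & purely_fa_ge0 (ba_jordan_neg mu)]].

(* [M] is the class of the measures P(x, .): [ba], [ca] or [pfa]. *)
Definition sub_Markov_kernel (M : set (set X -> R)) (P : X -> set X -> R) :
    Prop :=
  [/\ forall x E, measurable E -> 0 <= P x E <= 1,
      forall E, measurable E -> B (fun x => P x E)
    & forall x, M (P x)].

Definition Markov_kernel (M : set (set X -> R)) (P : X -> set X -> R) : Prop :=
  sub_Markov_kernel M P /\ (forall x, P x setT = 1).

End SetFunctions.

(* Main.v *)
Require Import Defs.
From HB Require Import structures.
From mathcomp Require Import all_boot all_order all_algebra.
From mathcomp Require Import all_classical all_reals all_analysis.
Import numFieldNormedType.Exports.

Import Order.TTheory GRing.Theory Num.Theory.

(** Immeasurability makes the countably additive part explicit.  A nonnegative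
    finitely additive [mu] has an atomic part, [atomic_part mu E], the sum of
    the masses [mu [set y]] over the points [y] of [E].  Finite additivity and
    monotonicity bound every finite partial sum by [mu E], so the atomic part
    is a well-defined countably additive measure below [mu]
    ([ca_atomic_part]).  Since it has the same point masses as [mu], the rest
    [mu - atomic_part mu] is nonnegative and vanishes on points; so does any
    countably additive measure below the rest, which is then zero because the
    cardinality of [X] is immeasurable.  Hence the rest is purely finitely
    additive ([points0_pfa]), and applying this to every [P x] gives the two
    kernels.  Measurability in [x] is automatic on a discrete space, and
    boundedness holds because the values lie between 0 and 1.

    For uniqueness, let [mu = mu1 + mu2] be any decomposition with nonnegative
    parts.  The atomic part of [mu2] is a countably additive measure below
    [mu2], hence zero, so [mu2] has no point mass ([pfa_point]) and [mu1] has
    the point masses of [mu].  By immeasurability again, [mu1] equals its own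
    atomic part ([ca_atomic]), that is, the atomic part of [mu]. *)

Local Open Scope classical_set_scope.
Local Open Scope ring_scope.

(** * Bounded additive set functions *)

Section SetFunctions.
Context {R : realType} {d : measure_display} {X : measurableType d}.
Implicit Types (mu nu : set X -> R) (E F : set X).

Lemma bounded_ge0_le (T : Type) (A : set T) (f : T -> R) (c : R) :
  (forall x, A x -> 0 <= f x <= c) -> [bounded f x | x in A].
Proof.
move=> f0c; exists c; split; first by rewrite num_real.
move=> M cM x Ax; have /andP[f0 fc] := f0c x Ax.
by rewrite /= ger0_norm//; exact: le_trans fc (ltW cM).
Qed.

Lemma ba_set0 mu : ba mu -> mu set0 = 0.
Proof.
move=> [addmu _]; have := addmu set0 set0 measurable0 measurable0 (setI0 _).
by rewrite setU0 /= => -[] /eqP; rewrite -subr_eq subrr eq_sym => /eqP.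
Qed.

Lemma ba_setD mu E F : ba mu -> measurable E -> measurable F -> F `<=` E ->
  mu (E `\` F) = mu E - mu F.
Proof.
move=> [addmu _] mE mF FE.
have := addmu F (E `\` F) mF (measurableD mE mF) (setDIK _ _).
by rewrite setDUK//= => -[] ->; rewrite addrAC subrr add0r.
Qed.

Lemma ba_le mu E F : ba mu -> (forall A, measurable A -> 0 <= mu A) ->
  measurable E -> measurable F -> F `<=` E -> mu F <= mu E.
Proof.
move=> bamu mu0 mE mF FE.
by rewrite -subr_ge0 -ba_setD//; apply/mu0/measurableD.
Qed.

(** Passing to real series gives access to the rule for subtracting limits and
    to the vanishing of the general term of a convergent series. *)
Lemma sigma_additiveP mu : sigma_additive (EFin \o mu) <->
  forall F : nat -> set X, (forall i, measurable (F i)) -> trivIset setT F ->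
  series (mu \o F) @ \oo --> mu (\bigcup_n F n).
Proof.
have sumE (F : nat -> set X) :
    (fun n => (\sum_(0 <= i < n) (EFin \o mu) (F i))%E)
    = EFin \o series (mu \o F).
  by apply/funext => n; rewrite /= /series/= sumEFin.
split=> H F mF tF.
  have := H F mF tF; rewrite sumE => /fine_cvg.
  by apply: cvg_trans.
rewrite sumE; apply: cvg_EFin; first exact: nearW.
exact: H.
Qed.

(** Along the constant sequence [set0] the series with general term [mu set0]
    converges, so its general term tends to 0. *)
Lemma sigma_additive_set0 mu : sigma_additive (EFin \o mu) -> mu set0 = 0.
Proof.
move=> /sigma_additiveP/(_ (fun=> set0) (fun=> measurable0)).
move=> /(_ (@trivIset_set0 _ _ _)).
move=> /cvgP/cvg_series_cvg_0 cvg0.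
apply: (@cvg_unique _ (@Rhausdorff R) (mu set0 @[_ --> \oo])) => //.
exact: cvg_cst.
Qed.

Lemma ca_ba mu : ca mu -> ba mu.
Proof.
move=> [sadd bmu]; split => //.
have mu0 : (EFin \o mu) set0 = 0%E by rewrite /= sigma_additive_set0.
apply/(additive2P mu0); rewrite semi_additiveE.
exact: sigma_additive_is_additive.
Qed.

Lemma bounded_sub mu nu :
  [bounded mu E | E in measurable] -> [bounded nu E | E in measurable] ->
  [bounded (mu \- nu) E | E in measurable].
Proof.
move=> [M [_ muM]] [N [_ nuN]]; exists (M + 1 + (N + 1)).
split; first by rewrite num_real.
move=> K MNK E mE; apply: le_trans (ltW MNK).
apply: le_trans (ler_normB _ _) _.
by apply: lerD; [apply: muM|apply: nuN] => //; rewrite ltrDl.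
Qed.

Lemma ba_sub mu nu : ba mu -> ba nu -> ba (mu \- nu).
Proof.
move=> [amu bmu] [anu bnu]; split; last exact: bounded_sub.
move=> E F mE mF EF /=.
have [->] := amu E F mE mF EF; have [->] := anu E F mE mF EF.
by rewrite opprD addrACA.
Qed.

Lemma ca_sub mu nu : ca mu -> ca nu -> ca (mu \- nu).
Proof.
move=> [/sigma_additiveP amu bmu] [/sigma_additiveP anu bnu].
split; last exact: bounded_sub.
apply/sigma_additiveP => F mF tF.
rewrite (_ : series _ = series (mu \o F) \- series (nu \o F)).
  by apply: cvgB; [exact: amu|exact: anu].
by apply/funext => n; rewrite /series/= sumrB.
Qed.

(** * Jordan decomposition of a nonnegative measure *)

Lemma ba_jordan_pos_ge0 mu E : ba mu -> (forall A, measurable A -> 0 <= mu A) ->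
  measurable E -> ba_jordan_pos mu E = mu E.
Proof.
move=> bamu mu0 mE.
have ubE : ubound [set mu F | F in [set F | measurable F /\ F `<=` E]] (mu E).
  by move=> _ [F [mF FE] <-]; exact: ba_le.
apply/eqP; rewrite eq_le; apply/andP; split.
  by apply: ge_sup => //; exists (mu E); exists E; [split|].
by apply: ub_le_sup; [exists (mu E)|exists E; [split|]].
Qed.

Lemma ba_jordan_neg_ge0 mu E : ba mu -> (forall A, measurable A -> 0 <= mu A) ->
  measurable E -> ba_jordan_neg mu E = 0.
Proof.
move=> bamu mu0 mE.
have lb0 : lbound [set mu F | F in [set F | measurable F /\ F `<=` E]] 0.
  by move=> _ [F [mF FE] <-]; exact: mu0.
have im0 : [set mu F | F in [set F | measurable F /\ F `<=` E]] 0.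
  by exists set0; [split; [exact: measurable0|exact: sub0set]|exact: ba_set0].
apply/eqP; rewrite oppr_eq0 eq_le; apply/andP; split.
  by apply: ge_inf => //; exists 0.
by apply: lb_le_inf => //; exists 0.
Qed.

(** The positive part of a nonnegative [mu] is [mu] and its negative part is 0,
    so pure finite additivity can be tested on [mu] itself. *)
Lemma pfa_ge0P mu : ba mu -> (forall A, measurable A -> 0 <= mu A) ->
  pfa mu <-> purely_fa_ge0 mu.
Proof.
move=> bamu mu0; split.
  move=> [_ [_ H] _]; split => // lam calam lammu.
  by apply: H => // E mE; rewrite ba_jordan_pos_ge0//; exact: lammu.
move=> [_ H]; split => //; split => [E mE|lam calam lammu E mE].
- by rewrite ba_jordan_pos_ge0//; exact: mu0.
- by apply: H => // F mF; have := lammu F mF; rewrite ba_jordan_pos_ge0.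
- by rewrite ba_jordan_neg_ge0.
- have := lammu E mE; rewrite ba_jordan_neg_ge0// => lam0.
  by apply/eqP; rewrite eq_le andbC.
Qed.

End SetFunctions.

(** * Atomic part on a discrete space *)

Section Discrete.
Context {R : realType} {d : measure_display} {X : measurableType d}.
Context (mX : forall E : set X, measurable E).
Implicit Types (mu nu : set X -> R) (E F : set X).

Lemma ba_sum_points mu (A : set X) : ba mu -> (forall E, 0 <= mu E) ->
  finite_set A -> (\sum_(y \in A) (mu [set y])%:E)%E = (mu A)%:E.
Proof.
move=> bamu mu0 finA.
have m0 B : (0 <= (EFin \o mu) B)%E by rewrite lee_fin.
have muE0 : (EFin \o mu) set0 = 0%E by rewrite /= ba_set0.
have addmu := (additive2P muE0).2 bamu.1.
pose m : {content set X -> \bar R} :=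
  HB.pack (EFin \o mu) (isContent.Build d X R (EFin \o mu) m0 addmu).
have := @measure_fin_bigcup d R X m X A (fun y => [set y]) finA.
rewrite bigcup_imset1 image_id => mA; rewrite -[RHS]/(m A) mA//.
apply/trivIsetP => x y _ _ xy; apply/seteqP; split => // z [/= -> /eqP].
by rewrite (negbTE xy).
Qed.

(** The sum over an arbitrary, possibly uncountable, set of points is taken in
    the extended reals; [atomic_partE] shows that [fine] loses nothing. *)
Definition atomic_part mu E : R := fine (\esum_(y in E) (mu [set y])%:E)%E.

Section Ge0.
Context (mu : set X -> R) (bamu : ba mu) (mu0 : forall E, 0 <= mu E).

Lemma esum_points_le E : (\esum_(y in E) (mu [set y])%:E <= (mu E)%:E)%E.
Proof.
apply: ge_ereal_sup => _ [A [finA AE] <-].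
by rewrite ba_sum_points// lee_fin ba_le.
Qed.

Lemma atomic_partE E :
  (atomic_part mu E)%:E = (\esum_(y in E) (mu [set y])%:E)%E.
Proof.
rewrite fineK// ge0_fin_numE; last by apply: esum_ge0 => y _; rewrite lee_fin.
exact: le_lt_trans (esum_points_le E) (ltry _).
Qed.

Lemma atomic_part_ge0 E : 0 <= atomic_part mu E.
Proof. by rewrite -lee_fin atomic_partE esum_ge0// => y _; rewrite lee_fin. Qed.

Lemma atomic_part_le E : atomic_part mu E <= mu E.
Proof. by rewrite -lee_fin atomic_partE esum_points_le. Qed.

Lemma atomic_part1 x : atomic_part mu [set x] = mu [set x].
Proof. by rewrite /atomic_part esum_set1// lee_fin. Qed.

(** Unconditional sums of nonnegative terms can be regrouped along any
    countable partition: this is where countable additivity comes from, even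
    though [mu] is only finitely additive. *)
Lemma ca_atomic_part : ca (atomic_part mu).
Proof.
split; last first.
  apply: (@bounded_ge0_le _ _ _ _ (mu setT)) => E _.
  by rewrite atomic_part_ge0 (le_trans (atomic_part_le E))// ba_le.
move=> F _ tF; rewrite /= atomic_partE nneseries_sum_bigcup//; last first.
  by move=> y; rewrite lee_fin.
under eq_fun do under eq_bigr do rewrite /= atomic_partE.
apply: is_cvg_nneseries => n _ _.
by rewrite esum_ge0// => y _; rewrite lee_fin.
Qed.

End Ge0.

(** The atomic part is an admissible test measure in the definition of pure
    finite additivity, so it must be zero, and it carries the mass of [x]. *)
Lemma pfa_point mu x : (forall E, 0 <= mu E) -> pfa mu -> mu [set x] = 0.
Proof.
move=> mu0 pmu; have bamu : ba mu by case: pmu.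
have [_ /(_ (atomic_part mu))] := (pfa_ge0P mu bamu (fun A _ => mu0 A)).1 pmu.
move=> /(_ (ca_atomic_part _ bamu mu0)) H.
rewrite -atomic_part1//; apply: H => // E _.
by rewrite atomic_part_ge0//= atomic_part_le.
Qed.

(** * Consequences of immeasurability *)

Context (immX : immeasurable R X).

(** Immeasurability, transferred from bundled extended-real measures to
    real-valued set functions. *)
Lemma ca_points0 mu : ca mu -> (forall E, 0 <= mu E) ->
  (forall x, mu [set x] = 0) -> forall E, mu E = 0.
Proof.
move=> camu mu0 mu1 E.
have m0 : (EFin \o mu) set0 = 0%E by rewrite /= (ba_set0 _ (ca_ba _ camu)).
have mge0 B : (0 <= (EFin \o mu) B)%E by rewrite lee_fin.
have sadd : semi_sigma_additive (EFin \o mu).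
  by rewrite semi_sigma_additiveE; case: camu.
pose m : {measure set X -> \bar R} :=
  HB.pack (EFin \o mu) (isMeasure.Build d X R (EFin \o mu) m0 mge0 sadd).
(* Restricting to the whole space bundles [m] as a finite measure. *)
have mT : (m setT < +oo)%E by exact: ltry.
have m1 x : mfrestr measurableT mT [set x] = 0%E.
  by rewrite /mfrestr /mrestr setIT /= mu1.
have := immX (mfrestr measurableT mT) m1 E (mX E).
by rewrite /= /mfrestr /mrestr setIT => -[].
Qed.

(** The difference between [mu] and its atomic part is countably additive,
    nonnegative and without point masses. *)
Lemma ca_atomic mu : ca mu -> (forall E, 0 <= mu E) -> mu = atomic_part mu.
Proof.
move=> camu mu0; have bamu := ca_ba _ camu; apply/funext => E; apply/eqP.
rewrite -subr_eq0; apply/eqP/(ca_points0 (mu \- atomic_part mu)).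
- exact/ca_sub/ca_atomic_part.
- by move=> F; rewrite subr_ge0 atomic_part_le.
- by move=> x /=; rewrite atomic_part1// subrr.
Qed.

(** A countably additive measure below [mu] has no point masses either, so
    immeasurability kills it. *)
Lemma points0_pfa mu : ba mu -> (forall E, 0 <= mu E) ->
  (forall x, mu [set x] = 0) -> pfa mu.
Proof.
move=> bamu mu0 mu1; apply/pfa_ge0P => //; split => // lam calam lammu E _.
apply: ca_points0 => // [F|x]; first by have /andP[] := lammu F (mX F).
have := lammu [set x] (mX _); rewrite mu1 => lam0.
by apply/eqP; rewrite eq_le andbC.
Qed.

End Discrete.

Theorem proposition3p1 (R : realType) (d : measure_display)
    (X : measurableType d) (P : X -> set X -> R) :
  arbitrary_discrete_space R X ->
  Markov_kernel ba P ->
  exists! Q : (X -> set X -> R) * (X -> set X -> R),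
    [/\ sub_Markov_kernel ca Q.1,
        sub_Markov_kernel pfa Q.2
      & forall (x : X) (E : set X), P x E = Q.1 x E + Q.2 x E].
Proof.
move=> [_ mX immX] [[P01 _ baP] _].
have P0 x E : 0 <= P x E by have /andP[] := P01 x E (mX E).
have B01 (f : X -> R) : (forall x, 0 <= f x <= 1) -> B f.
  move=> f01; split; first by move=> _ S _; exact: mX.
  by apply: (@bounded_ge0_le _ _ _ _ 1) => x _; exact: f01.
have a0 x E := atomic_part_ge0 mX _ (baP x) (P0 x) E.
have aP x E := atomic_part_le mX _ (baP x) (P0 x) E.
have a1 x E : 0 <= atomic_part (P x) E <= 1.
  by rewrite a0 (le_trans (aP x E))//; have /andP[] := P01 x E (mX E).
have c1 x E : 0 <= P x E - atomic_part (P x) E <= 1.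
  rewrite subr_ge0 aP; have /andP[_] := P01 x E (mX E).
  by apply: le_trans; rewrite gerBl.
exists (fun x => atomic_part (P x), fun x => P x \- atomic_part (P x)).
split.
  split=> /=.
  - split=> [x E _|E _|x]; [exact: a1|by apply: B01 => x; exact: a1|].
    exact: ca_atomic_part.
  - split=> [x E _|E _|x]; [exact: c1|by apply: B01 => x; exact: c1|].
    have caP := ca_atomic_part mX _ (baP x) (P0 x).
    apply: points0_pfa => //.
    + exact/ba_sub/ca_ba.
    + by move=> E; rewrite subr_ge0.
    + by move=> y /=; rewrite atomic_part1// subrr.
  - by move=> x E; rewrite addrC subrK.
move=> [Q1 Q2] /= [[Q101 _ caQ1] [Q201 _ pfaQ2] PQ].
have Q1E x : Q1 x = atomic_part (P x).
  rewrite [LHS]ca_atomic// => [|E]; last by have /andP[] := Q101 x E (mX E).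
  apply/funext => E; congr fine; apply: eq_esum => y _; congr EFin.
  rewrite PQ [X in _ + X]pfa_point// ?addr0// => F.
  by have /andP[] := Q201 x F (mX F).
congr pair; apply/funext => x; first by rewrite Q1E.
by apply/funext => E; rewrite /= PQ Q1E addrAC subrr add0r.
Qed.
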